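(* Let $d\ge 1$ and let $\mathcal{P}\in\mathscr{P}_d$ be a pencil of plane curves of degree $d$. If there exist two generators $C_f$ and $C_g$ of $\mathcal{P}$ and a base point $p$ of $\mathcal{P}$ such that $\mathrm{mult}_p(C_f)+\mathrm{mult}_p(C_g)>\frac{4d}{3}$, then $\mathcal{P}$ is unstable. If there exist two generators $C_f$ and $C_g$ of $\mathcal{P}$ and a base point $p$ of $\mathcal{P}$ such that $\mathrm{mult}_p(C_f)+\mathrm{mult}_p(C_g)\geq\frac{4d}{3}$, then $\mathcal{P}$ is not stable.
   Context: The ground field is $\mathbb{C}$. Let $S_d$ be the vector space of homogeneous forms of degree $d$ in three variables. A plane curve of degree $d$ is $C_f=\{f=0\}\subset\mathbb{P}^2$ with $0\ne f\in S_d$ (taken up to scalar), regarded as an effective divisor (possibly non-reduced or reducible). A pencil of plane curves of degree $d$ is a two-dimensional subspace of $S_d$; its members are the $C_f$ with $f$ a nonzero element of that subspace, any two distinct members are generators, and a base point is a point of $\mathbb{P}^2$ lying on all members. The space of all such pencils is $\mathscr{P}_d=Gr(2,S_d)$, embedded by Plücker coordinates in $\mathbb{P}(\Lambda^2 S_d)$. Stability: $SL(3)$ acts on $S_d$ by linear changes of coordinates, hence on $\Lambda^2S_d$ and on $\mathscr{P}_d\subset\mathbb{P}(\Lambda^2S_d)$. A point of a projective variety $X\subset\mathbb{P}(W)$ with linear $SL(3)$-action is semistable if, for a nonzero lift $\tilde{x}\in W$, $0\notin\overline{SL(3)\cdot\tilde{x}}$; it is stable if the orbit $SL(3)\cdot\tilde{x}$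 is closed in $W$ and the stabilizer of $\tilde{x}$ is finite; it is unstable if it is not semistable. $\mathrm{mult}_p(C)$ denotes the multiplicity of the curve $C$ at the point $p$. *)

(* Defs.v *)
From HB Require Import structures.
From mathcomp Require Import all_boot all_order all_algebra.
From mathcomp Require Import boolp classical_sets cardinality reals.
From mathcomp Require Import complex.
From mathcomp Require Import mpoly.

Set Implicit Arguments.
Unset Strict Implicit.
Unset Printing Implicit Defensive.

Import GRing.Theory Num.Theory VectorInternalTheory.
Local Open Scope ring_scope.
Local Open Scope classical_set_scope.

Section Zariski.
Variables (F : fieldType) (W : vectType F).

(* Polynomial functions on W are polynomials in the coordinates [v2r]; which
   basis is used does not matter. *)
Definition polyfun (q : {mpoly F[dim W]}) (w : W) : F := q.@[v2r w 0].

Definition zariski_closure (A : set W) : set W :=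
  [set w | forall q, (forall a, A a -> polyfun q a = 0) -> polyfun q w = 0].

Definition zariski_closed (A : set W) : Prop := zariski_closure A `<=` A.

End Zariski.

Section Stability.
Variables (F : fieldType) (W : vectType F).
Variable act : 'M[F]_3 -> W -> W.

Definition SL3 : set 'M[F]_3 := [set g | \det g = 1].

Definition SL3_orbit (w : W) : set W := [set act g w | g in SL3].

Definition stabilizer (w : W) : set 'M[F]_3 := [set g | SL3 g /\ act g w = w].

(* A point of P(W) is a line x of W, and its lifts are the nonzero vectors of
   x. For a linear action the conditions below hold for all lifts as soon as
   they hold for one. *)
Definition semistable (x : {vspace W}) : Prop :=
  exists w, [/\ w \in x, w != 0 & ~ zariski_closure (SL3_orbit w) 0].

Definition stable (x : {vspace W}) : Prop :=
  exists w, [/\ w \in x, w != 0, zariski_closed (SL3_orbit w)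
             & finite_set (stabilizer w)].

Definition unstable (x : {vspace W}) : Prop := ~ semistable x.

End Stability.

Section ExteriorSquare.
Variables (F : numFieldType) (V : vectType F).
Local Notation N := (dim V).

Definition symmetrize (M : 'M[F]_N) : 'M[F]_N := M + M^T.

Lemma symmetrize_is_linear : linear symmetrize.
Proof. by move=> a A B; rewrite /symmetrize linearP /= scalerDr addrACA. Qed.

HB.instance Definition _ :=
  GRing.isLinear.Build F 'M[F]_N 'M[F]_N _ symmetrize symmetrize_is_linear.

(* In a basis (e_i) of V, the bivector \sum_(i, j) M i j (e_i \otimes e_j) of
   V \otimes V is encoded by the matrix M; as F has characteristic 0, the
   exterior square is the space of skew-symmetric matrices. *)
Definition skew : {vspace 'M[F]_N} := lker (linfun symmetrize).

Lemma skewP (M : 'M[F]_N) : reflect (M^T = - M) (M \in skew).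
Proof.
rewrite memv_ker lfunE /= /symmetrize addrC addr_eq0; exact: eqP.
Qed.

Definition ext2 := subvs_of skew.
HB.instance Definition _ := Vector.on ext2.

Definition wedge_mx (u v : V) : 'M[F]_N :=
  (v2r u)^T *m v2r v - (v2r v)^T *m v2r u.

Lemma wedge_skew u v : wedge_mx u v \in skew.
Proof.
by apply/skewP; rewrite linearB /= !trmx_mul !trmxK opprB.
Qed.

Definition wedge (u v : V) : ext2 := Subvs (wedge_skew u v).

Lemma ext2_map_skew (phi : 'End(V)) (w : ext2) :
  (f2mx phi)^T *m vsval w *m f2mx phi \in skew.
Proof.
apply/skewP; have /skewP wT := subvsP w.
by rewrite !trmx_mul trmxK wT mulNmx mulmxN mulmxA.
Qed.

Definition ext2_map (phi : 'End(V)) (w : ext2) : ext2 :=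
  Subvs (ext2_map_skew phi w).

Lemma ext2_map_wedge (phi : 'End(V)) u v :
  ext2_map phi (wedge u v) = wedge (phi u) (phi v).
Proof.
have E x : v2r (phi x) = v2r x *m f2mx phi by rewrite unlock /= r2vK.
apply: val_inj; rewrite /= /wedge_mx !E !trmx_mul.
by rewrite mulmxBr mulmxBl !mulmxA.
Qed.

Lemma ext2_map_is_linear (phi : 'End(V)) : linear (ext2_map phi).
Proof.
move=> a u v; apply: val_inj => /=.
by rewrite mulmxDr mulmxDl -scalemxAr -scalemxAl.
Qed.

(* The subspace \Lambda^2 P of \Lambda^2 V; for \dim P = 2, this line is the
   image of P under the Pluecker embedding. *)
Definition plucker (P : {vspace V}) : {vspace ext2} :=
  <<[seq wedge u v | u <- vbasis P, v <- vbasis P]>>%VS.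

Lemma wedge_linearl v : linear (wedge^~ v).
Proof.
move=> a x y; apply: val_inj; rewrite /= /wedge_mx !linearP /=.
by rewrite mulmxDl -scalemxAl scalerBr scalerN addrACA.
Qed.

Lemma wedgeC u v : wedge v u = - wedge u v.
Proof. by apply: val_inj; rewrite /= /wedge_mx opprB. Qed.

Lemma wedgeuu u : wedge u u = 0.
Proof. by apply: val_inj; rewrite /= /wedge_mx subrr. Qed.

Lemma wedge_plucker (P : {vspace V}) u v :
  u \in P -> v \in P -> wedge u v \in plucker P.
Proof.
pose wl v := GRing.isLinear.Build F V ext2 _ (wedge^~ v) (wedge_linearl v).
pose wL v : {linear V -> ext2} := HB.pack (wedge^~ v) (wl v).
have cl x y : x \in P -> (forall i : 'I_(\dim P),
    wedge (vbasis P)`_i y \in plucker P) -> wedge x y \in plucker P.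
  move=> /coord_vbasis -> h; rewrite -[wedge _ _]/(wL y _) linear_sum.
  by apply: rpred_sum => i _; rewrite linearZ rpredZ //= h.
move=> uP vP; apply: (cl) => // i; rewrite wedgeC rpredN; apply: cl => // j.
by apply: memv_span; apply: allpairs_f; rewrite mem_nth ?size_tuple.
Qed.

Lemma plucker_line (P : {vspace V}) u v :
  basis_of P [:: u; v] -> plucker P = <[wedge u v]>%VS /\ wedge u v != 0.
Proof.
move=> uvP; have /andP[/eqP sP fP] := uvP; split.
  apply/eqP; rewrite eqEsubv; apply/andP; split; last first.
    by rewrite -memvE wedge_plucker // -sP memv_span ?inE ?eqxx ?orbT.
  apply/span_subvP => w /allpairsP[[x y] /= [xP yP ->]].
  have E z : z \in vbasis P -> exists a b, z = a *: u + b *: v.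
    move=> /vbasis_mem; rewrite -sP span_cons span_seq1 => /memv_addP[z1].
    by move=> /vlineP[a ->] [z2 /vlineP[b ->] ->]; exists a, b.
  have [a [b ->]] := E _ xP; have [a' [b' ->]] := E _ yP.
  pose wl v := GRing.isLinear.Build F V ext2 _ (wedge^~ v) (wedge_linearl v).
  pose wL v : {linear V -> ext2} := HB.pack (wedge^~ v) (wl v).
  have D c c' z : wedge (c *: u + c' *: v) z = c *: wedge u z + c' *: wedge v z.
    by rewrite -[LHS]/(wL z _) linearD !linearZ.
  rewrite D wedgeC [wedge v _]wedgeC !D !wedgeuu [wedge v u]wedgeC.
  rewrite !scaler0 ?add0r ?addr0.
  by rewrite rpredD ?rpredZ ?rpredN ?rpredZ ?rpredN ?memv_line.
move: fP; rewrite free_cons seq1_free => /andP[uNv v0].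
apply: contraNneq uNv => /(congr1 val)/= /eqP; rewrite subr_eq0 => /eqP E.
have {}E i j : v2r u 0 i * v2r v 0 j = v2r v 0 i * v2r u 0 j.
  by have /matrixP/(_ i j) := E; rewrite !mxE !big_ord1 !mxE.
have /rV0Pn[i vi] : v2r v != 0.
  by apply: contraNneq v0 => h; rewrite -[v]v2rK h linear0.
rewrite span_seq1; apply/vlineP; exists (v2r u 0 i / v2r v 0 i).
apply: (can_inj v2rK); rewrite linearZ; apply/rowP => j; rewrite mxE.
by rewrite mulrAC E mulrC mulKf.
Qed.

End ExteriorSquare.

Section Forms.
Variables (F : fieldType) (d : nat).
Local Notation Sd := (dhomog 3 F d).

Definition linsubst (A : 'M[F]_3) : 3.-tuple {mpoly F[3]} :=
  [tuple \sum_j A i j *: 'X_j | i < 3].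

Lemma linsubst_homog (A : 'M[F]_3) (f : Sd) :
  mpoly_of_dhomog f \mPo linsubst A \is d.-homog.
Proof.
have fd : mpoly_of_dhomog f \is d.-homog by exact: dhomog_is_dhomog.
rewrite comp_mpolyEX big_seq rpred_sum // => m mf.
have md : mdeg m = d by exact: (dhomog_mf fd).
rewrite rpredZ //.
suff : 'X_[m] \mPo linsubst A \is (mdeg m).-homog by rewrite md.
rewrite comp_mpolyX mdegE.
elim/big_rec2: _ => [|i k q _ hq]; first exact: dhomog1.
apply: dhomogM => //; rewrite tnth_mktuple.
suff h1 : \sum_j A i j *: 'X_j \is [in F[3], 1.-homog].
  by have := dhomogMn (m i) h1; rewrite mul1n.
apply: rpred_sum => j _.
by rewrite rpredZ // dhomogX /= mdeg1.
Qed.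

(* (g f)(x) = f(g^-1 x) *)
Definition form_act (g : 'M[F]_3) (f : Sd) : Sd :=
  DHomog (linsubst_homog (invmx g) f).

Lemma form_act_is_linear g : linear (form_act g).
Proof.
by move=> a u v; apply: val_inj; rewrite /= linearP.
Qed.

HB.instance Definition _ g :=
  GRing.isLinear.Build F Sd Sd _ (form_act g) (form_act_is_linear g).

Lemma form_act1 f : form_act 1%:M f = f.
Proof.
apply: val_inj; rewrite /= invmx1 -[RHS]comp_mpoly_id.
congr (_ \mPo _); apply: eq_from_tnth => i; rewrite !tnth_mktuple.
rewrite (bigD1 i) //= mxE eqxx scale1r big1 ?addr0 // => j ji.
by rewrite mxE eq_sym (negbTE ji) scale0r.
Qed.

Lemma form_actE g f (x : 'cV[F]_3) :
  (mpoly_of_dhomog (form_act g f)).@[x^~ 0] =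
  (mpoly_of_dhomog f).@[(invmx g *m x)^~ 0].
Proof.
rewrite /= comp_mpoly_meval; apply: meval_eq => i.
rewrite !tnth_mktuple mxE rmorph_sum; apply: eq_bigr => j _ /=.
by rewrite mevalZ mevalXU.
Qed.

End Forms.

Section Multiplicity.
Variable F : fieldType.

(* The order of vanishing at the origin, for q != 0. *)
Definition vanishing_order n (q : {mpoly F[n]}) : nat :=
  \big[minn/msize q]_(m <- msupp q) mdeg m.

(* The equation of C_f in the affine chart x_i = 1 of P^2, with coordinates
   centered at p (where p_i != 0). *)
Definition local_equation (f : {mpoly F[3]}) (p : 'cV[F]_3) (i : 'I_3) :
    {mpoly F[2]} :=
  f \mPo [tuple if unlift i k is Some j then 'X_j + (p k 0 / p i 0)%:MP else 1
         | k < 3].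

Definition mult (p : 'cV[F]_3) (f : {mpoly F[3]}) : nat :=
  if [pick i | p i 0 != 0] is Some i then vanishing_order (local_equation f p i)
  else 0%N.

End Multiplicity.

Section Pencils.
Variables (F : numFieldType) (d : nat).
Local Notation Sd := (dhomog 3 F d).

Definition pencil (P : {vspace Sd}) : Prop := \dim P = 2%N.

Definition generators (P : {vspace Sd}) (f g : Sd) : Prop :=
  basis_of P [:: f; g].

(* Points of P^2 are given by nonzero vectors of homogeneous coordinates. *)
Definition base_point (P : {vspace Sd}) (p : 'cV[F]_3) : Prop :=
  p != 0 /\ forall f : Sd, f \in P -> (mpoly_of_dhomog f).@[p^~ 0] = 0.

Definition bivector_act (g : 'M[F]_3) : ext2 Sd -> ext2 Sd :=
  ext2_map (linfun (@form_act F d g)).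

Definition stable_pencil (P : {vspace Sd}) : Prop :=
  stable bivector_act (plucker P).

Definition unstable_pencil (P : {vspace Sd}) : Prop :=
  unstable bivector_act (plucker P).

End Pencils.

(* Main.v *)
Require Import Defs.
From HB Require Import structures.
From mathcomp Require Import all_boot all_order all_algebra.
From mathcomp Require Import boolp classical_sets cardinality reals.
From mathcomp Require Import complex.
From mathcomp Require Import mpoly.

Set Implicit Arguments.
Unset Strict Implicit.
Unset Printing Implicit Defensive.

Import GRing.Theory Num.Theory VectorInternalTheory.
Local Open Scope ring_scope.

(** Only the easy half of the Hilbert-Mumford criterion is needed: one explicit
    one-parameter subgroup of SL(3) destabilizes the bivector of the pencil.

    Move the base point p to a coordinate point e_i by a linear change of
    coordinates A. Let lambda(t) act on forms by x_i -> t^-2 x_i and by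
    x_k -> t x_k for the other two coordinates. A monomial x^m of degree d is
    multiplied by t^(3 (d - m_i) - 2 d), and d - m_i is its degree in the affine
    coordinates centered at e_i. All monomials occurring in the transform of f
    satisfy d - m_i >= mult_p(f) (lemma [vanishing_order_local_le]), and likewise
    for g. Hence f /\ g is a sum of eigenvectors of A lambda(t) A^-1 whose
    weights t^e satisfy
      e >= 3 (mult_p(f) + mult_p(g)) - 4 d
    (lemma [destabilizing_one_ps]).

    When the right-hand side is positive, A lambda(t) A^-1 sends f /\ g to 0 as
    t -> 0, and 0 is in the closure of the orbit
    ([positive_weights_closure0]). When it is only nonnegative, the limit still
    exists: it is the sum w0 of the components of weight 0, and it is fixed by
    the whole one-parameter subgroup. If the orbit were closed it would contain
    w0, and the stabilizer of f /\ g, being conjugate to that of w0, would be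
    infinite ([nonnegative_weights_not_stable]).

    Limits are algebraic: a polynomial function that vanishes on
    \sum_i t^(e_i) u_i for all t != 0 is, along this curve, a polynomial in t
    with infinitely many zeros, so it also vanishes at t = 0. *)

(** * Limits of curves in the Zariski topology *)

Lemma poly_eq0_punctured (F : numFieldType) (p : {poly F}) :
  (forall t, t != 0 -> p.[t] = 0) -> p = 0.
Proof.
move=> p0; pose rs : seq F := [seq n.+1%:R | n <- iota 0 (size p)].
have Urs : uniq rs.
  rewrite map_inj_uniq ?iota_uniq // => m n /eqP.
  by rewrite eqr_nat eqSS => /eqP.
apply: (roots_geq_poly_eq0 (rs := rs)) => //; last by rewrite size_map size_iota.
by apply/allP => _ /mapP[n _ ->]; apply/rootP/p0; rewrite pnatr_eq0.
Qed.

Lemma horner_mmap (F : comNzRingType) n (q : {mpoly F[n]}) (h : 'I_n -> {poly F})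
    (t : F) :
  (mmap polyC h q).[t] = q.@[fun j => (h j).[t]].
Proof.
rewrite /mmap horner_sum mevalE; apply: eq_bigr => m _.
rewrite hornerM hornerC /mmap1 horner_prod; congr (_ * _).
by apply: eq_bigr => i _; rewrite horner_exp.
Qed.

(** The terms with e i = 0 are the value at t = 0 of the curve
    \sum_i t^(e i) u i. A polynomial function that vanishes on A restricts to a
    polynomial in t that vanishes for t != 0, hence also at t = 0. *)
Lemma zariski_closure_curve (F : numFieldType) (W : vectType F) (A : set W)
    (I : Type) (r : seq I) (e : I -> nat) (u : I -> W) :
  (forall t : F, t != 0 -> A (\sum_(i <- r) t ^+ e i *: u i)) ->
  zariski_closure A (\sum_(i <- r | e i == 0%N) u i).
Proof.
move=> hA q qA.
pose h j : {poly F} := \sum_(i <- r) (v2r (u i) 0 j)%:P * 'X^(e i).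
have hE t : polyfun q (\sum_(i <- r) t ^+ e i *: u i) = (mmap polyC h q).[t].
  rewrite horner_mmap; apply: meval_eq => j.
  rewrite linear_sum summxE horner_sum; apply: eq_bigr => i _.
  by rewrite linearZ mxE hornerM hornerC hornerXn mulrC.
have : polyfun q (\sum_(i <- r) 0 ^+ e i *: u i) = 0.
  rewrite hE (poly_eq0_punctured (p := mmap polyC h q)) ?horner0 // => t t0.
  by rewrite -hE; apply/qA/hA.
congr (polyfun q _ = 0); rewrite [RHS]big_mkcond; apply: eq_bigr => i _.
by rewrite expr0n; case: eqP; rewrite ?scale1r ?scale0r.
Qed.

(** * The easy half of the Hilbert-Mumford criterion *)

Lemma SL3_unit (F : fieldType) (g : 'M[F]_3) : SL3 g -> g \in unitmx.
Proof. by rewrite unitmxE /SL3 /= => ->; rewrite unitr1. Qed.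

Section LinearAction.
Variables (F : numFieldType) (W : vectType F).
Variable act : 'M[F]_3 -> W -> W.
Hypothesis act_linear : forall g, linear (act g).
Hypothesis act1 : forall w, act 1%:M w = w.
Hypothesis actM : forall g h w, g \in unitmx -> h \in unitmx ->
  act (g *m h) w = act g (act h w).

Lemma act_sum (I : Type) (r : seq I) (P : pred I) g (u : I -> W) :
  act g (\sum_(i <- r | P i) u i) = \sum_(i <- r | P i) act g (u i).
Proof.
pose al := GRing.isLinear.Build F W W _ (act g) (act_linear g).
pose aL : {linear W -> W} := HB.pack (act g) al.
exact: (linear_sum aL).
Qed.

(** If w0 = g w, then g^-1 lam(t) g fixes w for every t != 0, and an injective
    lam gives infinitely many such matrices. *)
Lemma infinite_stabilizer_one_parameter (w w0 : W) (lam : F -> 'M[F]_3) :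
    injective lam -> (forall t, t != 0 -> SL3 (lam t)) ->
    (forall t, t != 0 -> act (lam t) w0 = w0) ->
    SL3_orbit act w w0 -> ~ finite_set (stabilizer act w).
Proof.
move=> lamI lam1 lamw0 [g g1 gw] fin.
have gU := SL3_unit g1.
pose phi n : 'M[F]_3 := invmx g *m lam n.+1%:R *m g.
have phiI : injective phi.
  move=> m n /(congr1 (fun A => g *m A *m invmx g)).
  rewrite /phi !mulmxA mulmxV // !mul1mx !mulmxK // => /lamI /eqP.
  by rewrite eqr_nat eqSS => /eqP.
apply: infinite_nat.
suff /(sub_finite_set (B := stabilizer act w)) /(_ fin) :
    (phi @` setT `<=` stabilizer act w)%classic.
  by rewrite (eq_finite_set (inj_card_eq _)) // => ? ? _ _; apply: phiI.
move=> _ [n _ <-]; have n0 : n.+1%:R != 0 :> F by rewrite pnatr_eq0.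
have lU := SL3_unit (lam1 _ n0); split.
  rewrite /SL3 /phi /= !det_mulmx (lam1 _ n0 : \det _ = 1) mulr1 -det_mulmx.
  by rewrite mulVmx // det1.
by rewrite /phi !actM ?unitmx_mul ?unitmx_inv ?gU // gw lamw0 // -gw -actM
  ?unitmx_inv // mulVmx // act1.
Qed.

Section Weights.
Variables (lam : F -> 'M[F]_3) (I : eqType) (r : seq I) (e : I -> nat) (u : I -> W).
Hypothesis lamI : injective lam.
Hypothesis lam1 : forall t, t != 0 -> SL3 (lam t).
Hypothesis weight : forall i t, i \in r -> t != 0 ->
  act (lam t) (u i) = t ^+ e i *: u i.
Let w := \sum_(i <- r) u i.

Lemma weight_limit :
  zariski_closure (SL3_orbit act w) (\sum_(i <- r | e i == 0%N) u i).
Proof.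
apply: zariski_closure_curve => t t0; exists (lam t); first exact: lam1.
by rewrite act_sum; apply: eq_big_seq => i ir; rewrite weight.
Qed.

Lemma positive_weights_closure0 : (forall i, i \in r -> (0 < e i)%N) ->
  zariski_closure (SL3_orbit act w) 0.
Proof.
move=> e0; have := weight_limit; rewrite big_seq_cond big1 // => i.
by case/andP=> /e0; rewrite lt0n => /negbTE->.
Qed.

(** The limit of lam(t) w is the weight 0 part of w, which lam fixes; a closed
    orbit would contain it. *)
Lemma nonnegative_weights_not_stable :
  ~ (zariski_closed (SL3_orbit act w) /\ finite_set (stabilizer act w)).
Proof.
case=> cl; apply: (@infinite_stabilizer_one_parameter _ _ lam) (cl _ weight_limit) => //.
move=> t t0; rewrite act_sum big_seq_cond [RHS]big_seq_cond.
by apply: eq_bigr => i /andP[ir /eqP ei]; rewrite weight // ei scale1r.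
Qed.
End Weights.
End LinearAction.

(** * The action on forms and on bivectors *)

Lemma comp_mpolyA (R : comNzRingType) n k l (p : {mpoly R[n]})
    (lq : n.-tuple {mpoly R[k]}) (lr : k.-tuple {mpoly R[l]}) :
  (p \mPo lq) \mPo lr = p \mPo [tuple tnth lq i \mPo lr | i < n].
Proof.
rewrite (comp_mpolyEX p lq) (comp_mpolyEX p) linear_sum; apply: eq_bigr => m _.
rewrite linearZ /= !comp_mpolyX rmorph_prod; congr (_ *: _).
by apply: eq_bigr => i _; rewrite rmorphXn tnth_mktuple.
Qed.

Lemma linsubst_comp (F : fieldType) (A : 'M[F]_3) l (lr : 3.-tuple {mpoly F[l]}) i :
  tnth (linsubst A) i \mPo lr = \sum_j A i j *: tnth lr j.
Proof.
rewrite tnth_mktuple linear_sum; apply: eq_bigr => j _.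
by rewrite linearZ /= comp_mpolyXU -tnth_nth.
Qed.

Lemma comp_linsubstM (F : fieldType) (f : {mpoly F[3]}) (A B : 'M[F]_3) :
  (f \mPo linsubst A) \mPo linsubst B = f \mPo linsubst (A *m B).
Proof.
rewrite comp_mpolyA; congr (_ \mPo _); apply: eq_from_tnth => i.
rewrite tnth_mktuple linsubst_comp tnth_mktuple.
under eq_bigr do rewrite tnth_mktuple scaler_sumr.
rewrite exchange_big; apply: eq_bigr => k _; rewrite mxE scaler_suml.
by apply: eq_bigr => j _; rewrite scalerA.
Qed.

Lemma comp_linsubst_diag (F : fieldType) (v : 'rV[F]_3) (m : 'X_{1..3}) :
  'X_[m] \mPo linsubst (diag_mx v) = (\prod_k v 0 k ^+ m k) *: 'X_[m].
Proof.
rewrite comp_mpolyX [in RHS]mpolyXE_id -scaler_prod; apply: eq_bigr => k _.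
rewrite -exprZn tnth_mktuple (bigD1 k) //= mxE eqxx mulr1n big1 ?addr0 // => j jk.
by rewrite mxE eq_sym (negbTE jk) scale0r.
Qed.

(** Substitution composes contravariantly, which the inverse in the definition
    of [form_act] compensates. *)
Lemma form_actM (F : fieldType) d (g h : 'M[F]_3) (f : dhomog 3 F d) :
  g \in unitmx -> h \in unitmx -> form_act (g *m h) f = form_act g (form_act h f).
Proof.
move=> gU hU; apply: val_inj => /=; rewrite comp_linsubstM; congr (_ \mPo linsubst _).
have ghU : g *m h \in unitmx by rewrite unitmx_mul gU.
by apply: (can_inj (mulKmx ghU)); rewrite mulmxV // mulmxA mulmxK // mulmxV.
Qed.

Lemma v2r_lfun (F : fieldType) (V W : vectType F) (phi : 'Hom(V, W)) x :
  v2r (phi x) = v2r x *m f2mx phi.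
Proof. by rewrite unlock /= r2vK. Qed.

Lemma f2mx_unique (F : fieldType) (V W : vectType F) (phi : 'Hom(V, W)) A :
  (forall x, v2r (phi x) = v2r x *m A) -> f2mx phi = A.
Proof.
move=> phiA; apply/row_matrixP => i; rewrite !rowE.
by rewrite -[delta_mx 0 i]r2vK -v2r_lfun.
Qed.

Lemma ext2_map_comp (F : numFieldType) (V : vectType F) (phi psi : 'End(V))
    (w : ext2 V) :
  ext2_map (phi \o psi)%VF w = ext2_map phi (ext2_map psi w).
Proof.
apply: val_inj => /=.
have -> : f2mx (phi \o psi)%VF = f2mx psi *m f2mx phi.
  by apply: f2mx_unique => x; rewrite comp_lfunE !v2r_lfun mulmxA.
by rewrite trmx_mul !mulmxA.
Qed.

Lemma bivector_act_wedge (F : numFieldType) d (g : 'M[F]_3) (f h : dhomog 3 F d) :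
  bivector_act g (wedge f h) = wedge (form_act g f) (form_act g h).
Proof. by rewrite /bivector_act ext2_map_wedge !lfunE. Qed.

Lemma bivector_act_linear (F : numFieldType) d (g : 'M[F]_3) :
  linear (@bivector_act F d g).
Proof. exact: ext2_map_is_linear. Qed.

Lemma bivector_act1 (F : numFieldType) d (w : ext2 (dhomog 3 F d)) :
  bivector_act 1%:M w = w.
Proof.
apply: val_inj; rewrite /bivector_act /=.
rewrite (f2mx_unique (A := 1%:M)) ?trmx1 ?mul1mx ?mulmx1 // => f.
by rewrite mulmx1 lfunE /= form_act1.
Qed.

Lemma bivector_actM (F : numFieldType) d (g h : 'M[F]_3) (w : ext2 (dhomog 3 F d)) :
  g \in unitmx -> h \in unitmx ->
  bivector_act (g *m h) w = bivector_act g (bivector_act h w).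
Proof.
move=> gU hU; rewrite /bivector_act -ext2_map_comp; congr (ext2_map _ _).
by apply/lfunP => f; rewrite comp_lfunE !lfunE /= form_actM.
Qed.

(** * A one-parameter subgroup of SL(3) and its weights on monomials *)

(** As forms are transformed by the inverse matrix, t acts on the variables by
    x_i -> t^-2 x_i and x_k -> t x_k for k != i. *)
Definition one_ps (F : fieldType) (i : 'I_3) (t : F) : 'M[F]_3 :=
  diag_mx (\row_k if k == i then t ^+ 2 else t^-1).

Lemma one_ps_SL3 (F : fieldType) i (t : F) : t != 0 -> SL3 (one_ps i t).
Proof.
move=> t0; rewrite /SL3 /= det_diag (bigD1_ord i) //= mxE eqxx.
under eq_bigr do rewrite mxE eq_sym (negbTE (neq_lift _ _)).
by rewrite prodr_const card_ord -exprMn mulfV // expr1n.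
Qed.

(** The entries t^-1 separate the parameters, including 0 since 0^-1 = 0; the
    entry t^2 would not. *)
Lemma one_ps_inj (F : fieldType) i : injective (@one_ps F i).
Proof.
move=> s t /matrixP/(_ (lift i ord0) (lift i ord0)).
by rewrite !mxE !eqxx eq_sym (negbTE (neq_lift _ _)) => /invr_inj.
Qed.

Lemma invmx_one_ps (F : fieldType) i (t : F) :
  t != 0 -> invmx (one_ps i t) = one_ps i t^-1.
Proof.
move=> t0; have lU := SL3_unit (one_ps_SL3 i t0).
apply: (can_inj (mulKmx lU)); rewrite mulmxV // mulmx_diag -diag_const_mx.
congr diag_mx; apply/rowP => k; rewrite !mxE.
by case: eqP => _; rewrite ?invrK ?exprVn ?mulfV ?mulVf ?expf_neq0.
Qed.

(** Meaningful only for mdeg m = d; for other m the value is the default 0. *)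
Definition mon_form (F : fieldType) d (m : 'X_{1..3}) : dhomog 3 F d :=
  indhomog d 'X_[m].

Lemma mon_formE (F : fieldType) d (m : 'X_{1..3}) :
  mdeg m = d -> mpoly_of_dhomog (mon_form F d m) = 'X_[m].
Proof. by move=> md; rewrite /mon_form /indhomog insubdK // dhomogX /= md. Qed.

Lemma form_monE (F : fieldType) d (f : dhomog 3 F d) :
  f = \sum_(m <- msupp f) (mpoly_of_dhomog f)@_m *: mon_form F d m.
Proof.
apply: val_inj; rewrite /= linear_sum [LHS]mpolyE; apply: eq_big_seq => m mf.
rewrite linearZ /= mon_formE //.
exact: (dhomog_mf (dhomog_is_dhomog f)).
Qed.

(** The factor is t^(-2 m_i) t^(d - m_i) = t^(3 (d - m_i) - 2 d); the negative
    part of the exponent is kept as a denominator. *)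
Lemma one_ps_mon_form (F : fieldType) d i (t : F) (m : 'X_{1..3}) :
  t != 0 -> mdeg m = d ->
  form_act (one_ps i t) (mon_form F d m) =
  (t ^+ (3 * (d - m i)) / t ^+ (2 * d)) *: mon_form F d m.
Proof.
move=> t0 md; apply: val_inj.
rewrite linearZ /= mon_formE // invmx_one_ps // comp_linsubst_diag.
congr (_ *: _); rewrite (bigD1_ord i) //= mxE eqxx.
under eq_bigr do rewrite mxE eq_sym (negbTE (neq_lift _ _)) invrK.
have := md; rewrite mdegE (bigD1_ord i) //= -expr_sum => {}md.
set k := (\sum_(_ < _) _)%N in md *.
rewrite -md addKn; apply: (canRL (mulfK _)); first by rewrite expf_neq0.
rewrite -exprM exprVn -mulrA -exprD (mulrC (_ ^-1)).
apply: (canLR (mulfK _)); first by rewrite expf_neq0.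
by rewrite -exprD; congr (_ ^+ _); rewrite mulnDr addnCA addnC mulSn.
Qed.

(** * Multiplicity in terms of monomials *)

(** The substitution x_k -> x_k + (p_k / p_i) x_i for k != i, fixing x_i. As a
    map on points it is unipotent and sends e_i to p / p_i, so composing with it
    carries the behavior of a form at p to the coordinate point e_i. *)
Definition shear (F : fieldType) (p : 'cV[F]_3) i : 'M[F]_3 :=
  1%:M + ((p i 0)^-1 *: p - delta_mx i 0) *m delta_mx 0 i.

Lemma shearE (F : fieldType) (p : 'cV[F]_3) i k j :
  shear p i k j = (k == j)%:R + (p k 0 / p i 0 - (k == i)%:R) * (j == i)%:R.
Proof.
by rewrite !mxE big_ord1 !mxE !eqxx /= andbT mulrC [_^-1 * _]mulrC mulrC.
Qed.

(** The shear is 1 + N with N^2 = 0, so 1 - N is its inverse. *)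
Lemma shear_unit (F : fieldType) (p : 'cV[F]_3) i :
  p i 0 != 0 -> shear p i \in unitmx.
Proof.
move=> p0; rewrite /shear; set N := _ *m _.
have NN : N *m N = 0.
  rewrite /N mulmxA -(mulmxA _ (delta_mx 0 i)) -rowE.
  suff -> : row i ((p i 0)^-1 *: p - delta_mx i 0) = 0 by rewrite mulmx0 mul0mx.
  by apply/rowP => j; rewrite !mxE ord1 !eqxx mulVf // subrr.
suff /mulmx1_unit[] : (1%:M + N) *m (1%:M - N) = 1%:M by [].
by rewrite mulmxBr mulmx1 mulmxDl mul1mx NN addr0 addrK.
Qed.

Definition dehom (F : fieldType) (i : 'I_3) : 3.-tuple {mpoly F[2]} :=
  [tuple if unlift i k is Some j then 'X_j else 1 | k < 3].

Definition dehom_mnm (i : 'I_3) (m : 'X_{1..3}) : 'X_{1..2} :=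
  [multinom m (lift i j) | j < 2].

Lemma dehom_mon (F : fieldType) i m :
  'X_[m] \mPo dehom F i = 'X_[dehom_mnm i m].
Proof.
rewrite comp_mpolyX (bigD1_ord i) //= tnth_mktuple unlift_none expr1n mul1r.
rewrite mpolyXE_id; apply: eq_bigr => j _.
by rewrite tnth_mktuple liftK mnmE.
Qed.

Lemma mdeg_dehom i m : mdeg m = (m i + mdeg (dehom_mnm i m))%N.
Proof.
rewrite !mdegE (bigD1_ord i) //=; congr addn.
by apply: eq_bigr => j _; rewrite mnmE.
Qed.

Lemma dehom_mnm_inj i m n : mdeg m = mdeg n -> dehom_mnm i m = dehom_mnm i n -> m = n.
Proof.
move=> mn rmn; apply/mnmP => k; case: (unliftP i k) => [j|] ->.
  by have /mnmP/(_ j) := rmn; rewrite !mnmE.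
by move: mn; rewrite !(mdeg_dehom i) rmn => /addIn.
Qed.

(** Setting x_i = 1 does not merge monomials of a homogeneous form, as the
    exponent of x_i is recovered from the degree. *)
Lemma mcoeff_dehom (F : fieldType) d (f : {mpoly F[3]}) i m :
  f \is d.-homog -> mdeg m = d -> (f \mPo dehom F i)@_(dehom_mnm i m) = f@_m.
Proof.
move=> fd md; rewrite comp_mpolyEX [in RHS](mpolyE f) !linear_sum.
apply: eq_big_seq => n nf; rewrite !linearZ /= dehom_mon !mcoeffX.
have nd : mdeg n = d by exact: (dhomog_mf fd).
congr (_ * _%:R); congr nat_of_bool; apply/eqP/eqP => [|->//].
by apply: dehom_mnm_inj; rewrite nd md.
Qed.

Lemma local_equation_shear (F : fieldType) (f : {mpoly F[3]}) (p : 'cV[F]_3) i :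
  p i 0 != 0 -> local_equation f p i = (f \mPo linsubst (shear p i)) \mPo dehom F i.
Proof.
move=> p0; rewrite comp_mpolyA; congr (_ \mPo _).
apply: eq_from_tnth => k; rewrite [LHS]tnth_mktuple [RHS]tnth_mktuple linsubst_comp.
under eq_bigr do rewrite shearE tnth_mktuple scalerDl.
rewrite big_split /= (bigD1 k) //= eqxx scale1r big1 => [|j jk]; last first.
  by rewrite eq_sym (negbTE jk) scale0r.
rewrite addr0 (bigD1 i) //= eqxx mulr1 unlift_none big1 => [|j ji]; last first.
  by rewrite (negbTE ji) mulr0 scale0r.
rewrite addr0; case: (unliftP i k) => [j|] ->.
  by rewrite eq_sym (negbTE (neq_lift _ _)) subr0 -mul_mpolyC mulr1.
by rewrite eqxx divff // subrr scale0r addr0.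
Qed.

Lemma vanishing_order_le (F : fieldType) n (q : {mpoly F[n]}) m :
  m \in msupp q -> (vanishing_order q <= mdeg m)%N.
Proof.
rewrite /vanishing_order; elim: (msupp q : seq _) => // k r IHr.
rewrite inE big_cons geq_min => /orP[/eqP->|/IHr->]; last by rewrite orbT.
by rewrite leqnn.
Qed.

(** A monomial x^m of the sheared form becomes, after setting x_i = 1, a monomial
    of degree d - m_i of the local equation at p, with the same coefficient. *)
Lemma vanishing_order_local_le (F : fieldType) d (f : dhomog 3 F d) (p : 'cV[F]_3) i m :
  p i 0 != 0 -> m \in msupp (form_act (invmx (shear p i)) f) ->
  (vanishing_order (local_equation f p i) <= d - m i)%N.
Proof.
move=> p0 mf; have hd := dhomog_is_dhomog (form_act (invmx (shear p i)) f).
have md : mdeg m = d by exact: (dhomog_mf hd).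
have -> : (d - m i = mdeg (dehom_mnm i m))%N by rewrite -md (mdeg_dehom i) addKn.
apply: vanishing_order_le; rewrite mcoeff_msupp local_equation_shear //.
move: mf hd; rewrite mcoeff_msupp /= invmxK => mf hd.
by rewrite (mcoeff_dehom _ hd).
Qed.

(** * Weights of the bivector of a pencil *)

Lemma wedge_linearr (F : numFieldType) (V : vectType F) (u : V) : linear (wedge u).
Proof.
move=> a x y; rewrite wedgeC wedge_linearl opprD -scalerN.
by rewrite -(wedgeC x u) -(wedgeC y u).
Qed.

Lemma wedgeZ (F : numFieldType) (V : vectType F) (a b : F) (u v : V) :
  wedge (a *: u) (b *: v) = (a * b) *: wedge u v.
Proof.
have wedge0l x : wedge 0 x = 0 :> ext2 V.
  by apply: val_inj; rewrite /= /wedge_mx !linear0 mul0mx addr0.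
have Zl c x y : wedge (c *: x) y = c *: wedge x y :> ext2 V.
  by rewrite -[c *: x]addr0 wedge_linearl wedge0l addr0.
by rewrite Zl wedgeC Zl -scalerN -wedgeC scalerA.
Qed.

Lemma wedge_sum (F : numFieldType) (V : vectType F) (I J : Type) (r : seq I)
    (s : seq J) (u : I -> V) (v : J -> V) :
  wedge (\sum_(i <- r) u i) (\sum_(j <- s) v j) =
  \sum_(ij <- [seq (i, j) | i <- r, j <- s]) wedge (u ij.1) (v ij.2).
Proof.
pose wl v := GRing.isLinear.Build F V (ext2 V) _ (fun x => wedge x v) (wedge_linearl v).
pose wL v : {linear V -> ext2 V} := HB.pack (fun x => wedge x v) (wl v).
pose wr v := GRing.isLinear.Build F V (ext2 V) _ (wedge v) (wedge_linearr v).
pose wR v : {linear V -> ext2 V} := HB.pack (wedge v) (wr v).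
rewrite big_allpairs_dep -[LHS]/(wL (\sum_(j <- s) v j) _) linear_sum; apply: eq_bigr => i _.
exact: (linear_sum (wR _)).
Qed.

Lemma one_ps_weightM (F : fieldType) (t : F) a b d :
  t != 0 -> (4 * d <= 3 * (a + b))%N ->
  t ^+ (3 * a) / t ^+ (2 * d) * (t ^+ (3 * b) / t ^+ (2 * d)) =
  t ^+ (3 * (a + b) - 4 * d).
Proof.
move=> t0 hab; rewrite mulf_div -!exprD -mulnDr -mulnDl.
apply: (canLR (mulfK _)); first by rewrite expf_neq0.
by rewrite -exprD subnK.
Qed.

(** In the coordinates given by the shear, f and g are sums of monomials x^m and
    x^n, and each wedge of two such monomials is an eigenvector; the sum is
    indexed by these pairs (m, n). The scalar c lets the result apply to every
    lift of the line of the pencil. *)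
Lemma destabilizing_one_ps (F : numFieldType) d (f g : dhomog 3 F d)
    (p : 'cV[F]_3) (c : F) :
  p != 0 -> (4 * d <= 3 * (mult p f + mult p g))%N ->
  exists (lam : F -> 'M[F]_3) (r : seq ('X_{1..3} * 'X_{1..3}))
         (e : 'X_{1..3} * 'X_{1..3} -> nat)
         (u : 'X_{1..3} * 'X_{1..3} -> ext2 (dhomog 3 F d)),
    [/\ injective lam /\ (forall t, t != 0 -> SL3 (lam t)),
        c *: wedge f g = \sum_(mn <- r) u mn,
        forall mn t, mn \in r -> t != 0 ->
          bivector_act (lam t) (u mn) = t ^+ e mn *: u mn &
        forall mn, mn \in r ->
          (3 * (mult p f + mult p g) - 4 * d <= e mn)%N].
Proof.
move=> p0 hfg.
have [i pi0 hmult] : exists2 i, p i 0 != 0 &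
    forall q, mult p q = vanishing_order (local_equation q p i).
  (* The chart depends on p alone, so it is the same for f and g. *)
  rewrite /mult; case: pickP => [i pi0|p_eq0]; first by exists i.
  by case/eqP: p0; apply/colP => i; have /negbFE/eqP := p_eq0 i; rewrite mxE.
rewrite !hmult in hfg *.
pose A := shear p i; have AU : A \in unitmx by exact: shear_unit.
pose loc (q : dhomog 3 F d) := form_act (invmx A) q.
pose x (q : dhomog 3 F d) m := (mpoly_of_dhomog (loc q))@_m *: form_act A (mon_form F d m).
have qE q : q = \sum_(m <- msupp (loc q)) x q m.
  rewrite -[LHS]form_act1 -(mulmxV AU) form_actM ?unitmx_inv // [form_act _ q]form_monE.
  by rewrite linear_sum; apply: eq_bigr => m _; rewrite linearZ.
exists (fun t => A *m one_ps i t *m invmx A).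
exists [seq (m, n) | m <- msupp (loc f), n <- msupp (loc g)].
exists (fun mn : 'X_{1..3} * 'X_{1..3} => 3 * ((d - mn.1 i) + (d - mn.2 i)) - 4 * d)%N.
exists (fun mn : 'X_{1..3} * 'X_{1..3} => c *: wedge (x f mn.1) (x g mn.2)); split.
- split=> [s t /(can_inj (mulmxKV AU))/(can_inj (mulKmx AU)) /one_ps_inj //|t t0].
  rewrite /SL3 /= !det_mulmx (one_ps_SL3 i t0 : \det _ = 1) mulr1 -det_mulmx.
  by rewrite mulmxV // det1.
- by rewrite [in LHS](qE f) [in LHS](qE g) wedge_sum scaler_sumr.
- move=> _ t /allpairsP[[m n] /= [mf ng ->]] t0 /=.
  have lU := SL3_unit (one_ps_SL3 i t0).
  have act_x q k : k \in msupp (loc q) -> form_act (A *m one_ps i t *m invmx A) (x q k) =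
      (t ^+ (3 * (d - k i)) / t ^+ (2 * d)) *: x q k.
    move=> kq; rewrite !form_actM ?unitmx_mul ?unitmx_inv ?AU //.
    rewrite /x !linearZ /= -[form_act (invmx A) _]form_actM ?unitmx_inv // mulVmx // form_act1.
    rewrite one_ps_mon_form //; last exact: (dhomog_mf (dhomog_is_dhomog (loc q))).
    by rewrite linearZ /= !scalerA mulrC.
  rewrite -[c *: _]addr0 bivector_act_linear.
  have -> : bivector_act (A *m one_ps i t *m invmx A) 0 = 0 :> ext2 (dhomog 3 F d).
    by rewrite /bivector_act; apply: val_inj; rewrite /= mulmx0 mul0mx.
  rewrite !addr0 bivector_act_wedge !act_x // wedgeZ !scalerA; congr (_ *: _).
  rewrite [LHS]mulrC; congr (_ * _).
  have mle := vanishing_order_local_le pi0 mf; have nle := vanishing_order_local_le pi0 ng.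
  by rewrite -one_ps_weightM // (leq_trans hfg) // leq_mul2l /= leq_add.
move=> _ /allpairsP[[m n] /= [mf ng ->]] /=.
have mle := vanishing_order_local_le pi0 mf; have nle := vanishing_order_local_le pi0 ng.
by rewrite leq_sub2r // leq_mul2l /= leq_add.
Qed.

Theorem theorem1p3 (R : realType) (d : nat) (hd : (1 <= d)%N)
    (P : {vspace dhomog 3 R[i] d}) (hP : pencil P) :
  ((exists (f g : dhomog 3 R[i] d) (p : 'cV[R[i]]_3),
      [/\ generators P f g, base_point P p &
          (4 * d)%:R / 3 < (mult p f + mult p g)%:R :> rat]) ->
     unstable_pencil P) /\
  ((exists (f g : dhomog 3 R[i] d) (p : 'cV[R[i]]_3),
      [/\ generators P f g, base_point P p &
          (4 * d)%:R / 3 <= (mult p f + mult p g)%:R :> rat]) ->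
     ~ stable_pencil P).
Proof.
split=> -[f [g [p [/plucker_line[plE _] [p0 _]]]]].
  rewrite ltr_pdivrMr // -natrM ltr_nat [ltnRHS]mulnC => hfg.
  case=> w []; rewrite plE => /vlineP[c ->] _; apply.
  have [lam [r [e [u [[lamI lam1] -> weight he]]]]] :=
    destabilizing_one_ps c p0 (ltnW hfg).
  apply: (positive_weights_closure0 (@bivector_act_linear _ d) lam1 weight) => mn /he.
  by apply: leq_trans; rewrite subn_gt0.
rewrite ler_pdivrMr // -natrM ler_nat [leqRHS]mulnC => hfg.
case=> w []; rewrite plE => /vlineP[c ->] _ cl fin.
have [lam [r [e [u [[lamI lam1] wE weight he]]]]] :=
  destabilizing_one_ps c p0 hfg.
rewrite wE in cl fin.
exact: (nonnegative_weights_not_stable (@bivector_act_linear _ d)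
  (@bivector_act1 _ d) (@bivector_actM _ d) lamI lam1 weight).
Qed.
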